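(* Let $\mathbb{F}$ be a field of characteristic $p>2$, let $\mathfrak{g}=\tilde{P}(2)$ over $\mathbb{F}$, let $a,b\in\mathbb{F}_p$, and let $K(\lambda)$ be the Kac module of $\mathfrak{g}$ with $\lambda=a\varepsilon_1+b\varepsilon_2$. Then the following weight spaces of $K(\lambda)$ are given by (equalities involving $a+b$ being in $\mathbb{F}_p$): $$K(\lambda)_{(-2,0)}=\begin{cases}\langle 1\otimes v_{\Phi(b)}\mid 0\rangle, & \Phi(b)\in\overline{0,\tfrac{p-3}{2}}\cup\{p-2\}\text{ and }a+b=-2,\\ \langle 0\mid\gamma\otimes v_{\Phi(b+1)}\rangle, & \Phi(b)\in\overline{0,\tfrac{p-5}{2}}\cup\{p-1,p-3\}\text{ and }a+b=-4,\\ \langle 0\mid 0\rangle, & \text{otherwise;}\end{cases}$$ $$K(\lambda)_{(-1,-1)}=\begin{cases}\langle 1\otimes v_{\Phi(b+1)}\mid 0\rangle, & \Phi(b)\in\overline{0,\tfrac{p-3}{2}}\cup\{p-1\}\text{ and }a+b=-2,\\ \langle 0\mid\gamma\otimes v_{\Phi(b+2)}\rangle, & \Phi(b)\in\overline{0,\tfrac{p-5}{2}}\cup\{p-1,p-2\}\text{ and }a+b=-4,\\ \langle 0\mid 0\rangle, & \text{otherwise;}\end{cases}$$ $$K(\lambda)_{(-1,1)}=\begin{cases}\langle 1\otimes v_{\Phi(b-1)}\mid 0\rangle, & \Phi(b)\in\overline{1,\tfrac{p-1}{2}}\cup\{p-1\}\text{ and }a+b=0,\\ \langle 0\mid\gamma\otimes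 v_{\Phi(b)}\rangle, & \Phi(b)\in\overline{0,\tfrac{p-3}{2}}\cup\{p-2\}\text{ and }a+b=-2,\\ \langle 0\mid 0\rangle, & \text{otherwise;}\end{cases}$$ $$K(\lambda)_{(0,-2)}=\begin{cases}\langle 1\otimes v_{\Phi(b+2)}\mid 0\rangle, & \Phi(b)\in\overline{0,\tfrac{p-3}{2}}\cup\{p-2\}\text{ and }a+b=-2,\\ \langle 0\mid\gamma\otimes v_{\Phi(b+3)}\rangle, & \Phi(b)\in\overline{0,\tfrac{p-5}{2}}\cup\{p-1,p-3\}\text{ and }a+b=-4,\\ \langle 0\mid 0\rangle, & \text{otherwise;}\end{cases}$$ $$K(\lambda)_{(1,-1)}=\begin{cases}\langle 1\otimes v_{\Phi(b+1)}\mid 0\rangle, & \Phi(b)\in\overline{1,\tfrac{p-1}{2}}\cup\{p-1\}\text{ and }a+b=0,\\ \langle 0\mid\gamma\otimes v_{\Phi(b+2)}\rangle, & \Phi(b)\in\overline{0,\tfrac{p-3}{2}}\cup\{p-2\}\text{ and }a+b=-2,\\ \langle 0\mid 0\rangle, & \text{otherwise;}\end{cases}$$ $$K(\lambda)_{(1,1)}=\begin{cases}\langle 1\otimes v_{\Phi(b-1)}\mid 0\rangle, & \Phi(b)\in\overline{1,\tfrac{p+1}{2}}\text{ and }a+b=2,\\ \langle 0\mid\gamma\otimes v_{\Phi(b)}\rangle, & \Phi(b)\in\overline{0,\tfrac{p-1}{2}}\text{ and }a+b=0,\\ \langle 0\mid 0\rangle, & \text{otherwise;}\end{cases}$$ $$K(\lambda)_{(0,0)}=\begin{cases}\langle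 1\otimes v_{\Phi(b)}\mid 0\rangle, & \Phi(b)\in\overline{0,\tfrac{p-1}{2}}\text{ and }a+b=0,\\ \langle 0\mid\gamma\otimes v_{\Phi(b+1)}\rangle, & \Phi(b)\in\overline{0,\tfrac{p-3}{2}}\cup\{p-1\}\text{ and }a+b=-2,\\ \langle 0\mid 0\rangle, & \text{otherwise.}\end{cases}$$
   Context: All vector spaces are finite-dimensional over a field $\mathbb{F}$ of characteristic $p>2$; $\mathbb{F}_p\subseteq\mathbb{F}$ is the prime field. For $c\in\mathbb{F}_p$, $\Phi(c)\in\{0,1,\dots,p-1\}\subseteq\mathbb{Z}$ is the integer with $\Phi(c)\equiv c \pmod p$. For $c,d\in\mathbb{Z}$, $\overline{c,d}=\{x\in\mathbb{Z}\mid c\le x\le d\}$ (empty if $c>d$). The notation $\langle x\mid y\rangle$ means the $\mathbb{Z}_2$-graded space spanned by the even vector $x$ and the odd vector $y$. The Lie superalgebra. $\mathfrak{g}=\tilde{P}(2)$ is the subalgebra of $\mathfrak{gl}(2|2)$ (with supercommutator) of all $4\times4$ block matrices $\begin{pmatrix}A&B\\ C&-A^T\end{pmatrix}$ with $A,B,C$ of size $2\times 2$, $B=B^T$, $C=-C^T$; block diagonal matrices are even and block off-diagonal matrices are odd. With $e_{ij}$ the matrix units, put $\gamma=e_{41}-e_{32}$, $h_1=e_{33}-e_{11}$, $h_2=e_{44}-e_{22}$, $\alpha=e_{43}-e_{12}$, $\beta=e_{34}-e_{21}$. Then $\mathfrak{g}=\mathfrak{g}_{-1}\oplus\mathfrak{g}_0\oplus\mathfrak{g}_{+1}$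 with bases: $\gamma$ of $\mathfrak{g}_{-1}$; $h_1,h_2,\alpha,\beta$ of $\mathfrak{g}_0$; $e_{13},e_{24},e_{14}+e_{23}$ of $\mathfrak{g}_{+1}$. Let $\mathfrak{h}=\langle h_1,h_2\rangle$ and let $\varepsilon_1,\varepsilon_2\in\mathfrak{h}^*$ satisfy $\varepsilon_i(h_j)=\delta_{ij}$. The Kac module. For $\lambda=a\varepsilon_1+b\varepsilon_2$ with $a,b\in\mathbb{F}_p$, $M(\lambda)$ is the simple $\mathfrak{g}_0$-module with basis $v_0,v_1,\dots,v_{\Phi(b-a)}$ and action $h_1v_k=(a+k)v_k$, $h_2v_k=(b-k)v_k$, $\alpha v_k=k(b-a-k+1)v_{k-1}$, $\beta v_k=v_{k+1}$ (with $v_{-1}=0$ and $v_{\Phi(b-a)+1}=0$). Let $\mathfrak{g}_{+1}$ act on $M(\lambda)$ by zero and set $K(\lambda)=U(\mathfrak{g})\otimes_{U(\mathfrak{g}_0\oplus\mathfrak{g}_{+1})}M(\lambda)$. It has basis $1\otimes v_k$ (even), $\gamma\otimes v_k$ (odd), $0\le k\le\Phi(b-a)$; $h_1,h_2$ act on $1\otimes v_k$ by the scalars $a+k$, $b-k$ and on $\gamma\otimes v_k$ by $a+k+1$, $b-k+1$. For $i,j\in\mathbb{Z}$ (read in $\mathbb{F}_p$), $K(\lambda)_{(i,j)}$ is the weight space $\{w\in K(\lambda)\mid h_1w=iw,\ h_2w=jw\}$, i.e. the weight space of weight $i\varepsilon_1+j\varepsilon_2$. The seven spaces listed in the claim are those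 whose weights are the weights of $\mathfrak{g}$ under the adjoint action of $\mathfrak{h}$ (''target-weight spaces''). *)

(* Defs.v *)
From HB Require Import structures.
From mathcomp Require Import all_boot all_order all_algebra.
From mathcomp Require Import boolp finmap monalg ring.

Set Implicit Arguments.
Unset Strict Implicit.
Unset Printing Implicit Defensive.

Import GRing.Theory.
Local Open Scope ring_scope.
Local Open Scope quotient_scope.

Section Span.
Variables (F : fieldType) (V : lmodType F) (S : V -> Prop).

Definition lspan : {pred V} := fun x =>
  `[< forall P : V -> Prop, P 0 ->
        (forall (c : F) u v, P u -> P v -> P (c *: u + v)) ->
        (forall s, S s -> P s) -> P x >].

Lemma lspan_gen s : S s -> s \in lspan.
Proof. by move=> Ss; apply/asboolP => P _ _; apply. Qed.

Lemma lspan_submod : submod_closed lspan.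
Proof.
split=> [|c u v /asboolP uP /asboolP vP]; apply/asboolP => P P0 PD PS //.
by apply: (PD); [apply: uP | apply: vP].
Qed.

HB.instance Definition _ :=
  GRing.isSubmodClosed.Build F V lspan lspan_submod.

Lemma lspan_ker (W : lmodType F) (f : {linear V -> W}) x :
  (forall s, S s -> f s = 0) -> x \in lspan -> f x = 0.
Proof.
move=> f0 /asboolP /(_ (fun y => f y = 0)); apply=> //; first exact: linear0.
by move=> c u v u0 v0; rewrite linearP u0 v0 scaler0 addr0.
Qed.

Definition lquot := {ideal_quot lspan}.
HB.instance Definition _ := GRing.Zmodule.on lquot.
HB.instance Definition _ := EqQuotient.on lquot.

Definition lpi (x : V) : lquot := \pi_lquot x.

Lemma lpi_eq x y : (lpi x == lpi y) = (x - y \in lspan).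
Proof. by rewrite Quotient.idealrBE. Qed.

Lemma lpi_eq0 x : (lpi x = 0) <-> (x \in lspan).
Proof.
have -> : 0 = lpi 0 by rewrite /lpi raddf0.
by split=> [/eqP|x0]; [|apply/eqP]; rewrite lpi_eq subr0.
Qed.

Lemma lpi_repr (q : lquot) : lpi (repr q) = q.
Proof. exact: reprK. Qed.

Lemma repr_lpi x : repr (lpi x) - x \in lspan.
Proof. by rewrite -lpi_eq lpi_repr. Qed.

Definition lquot_scale (c : F) (q : lquot) : lquot := lpi (c *: repr q).

Lemma lpiZ c x : lquot_scale c (lpi x) = lpi (c *: x).
Proof. by apply/eqP; rewrite lpi_eq -scalerBr rpredZ // repr_lpi. Qed.

Lemma lpiD x y : lpi x + lpi y = lpi (x + y).
Proof. by rewrite /lpi raddfD. Qed.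

Fact lquot_scaleA c d q :
  lquot_scale c (lquot_scale d q) = lquot_scale (c * d) q.
Proof. by rewrite -[q]lpi_repr !lpiZ scalerA. Qed.

Fact lquot_scale1 : left_id 1 lquot_scale.
Proof. by move=> q; rewrite -[q]lpi_repr lpiZ scale1r. Qed.

Fact lquot_scaleDr : right_distributive lquot_scale +%R.
Proof.
by move=> c p q; rewrite -[p]lpi_repr -[q]lpi_repr lpiD !lpiZ lpiD scalerDr.
Qed.

Fact lquot_scaleDl q : {morph lquot_scale^~ q : c d / c + d}.
Proof. by move=> c d; rewrite -[q]lpi_repr !lpiZ lpiD scalerDl. Qed.

HB.instance Definition _ := GRing.Zmodule_isLmodule.Build F lquot
  lquot_scaleA lquot_scale1 lquot_scaleDr lquot_scaleDl.

Fact lpi_is_linear : linear lpi.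
Proof. by move=> c x y; rewrite -lpiD -lpiZ. Qed.

HB.instance Definition _ := GRing.isLinear.Build F V lquot _ lpi lpi_is_linear.

End Span.

Section LinearExtension.
Variables (F : fieldType) (K : choiceType) (W : lmodType F) (h : K -> W).

Definition lin_ext (g : {malg F[K]}) : W :=
  \sum_(k <- msupp g) g@_k *: h k.

Lemma lin_extEw (d : {fset K}) g : (msupp g `<=` d)%fset ->
  lin_ext g = \sum_(k <- d) g@_k *: h k.
Proof.
move=> le; rewrite /lin_ext (big_fset_incl _ le) //= => x _ /mcoeff_outdom ->.
by rewrite scale0r.
Qed.

Lemma lin_extUZ c k : lin_ext << c *g k >> = c *: h k.
Proof. by rewrite (lin_extEw msuppU_le) big_seq_fset1 mcoeffUU. Qed.

Lemma lin_extU k : lin_ext << k >> = h k.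
Proof. by rewrite lin_extUZ scale1r. Qed.

Fact lin_ext_is_linear : linear lin_ext.
Proof.
move=> c x y; pose d := (msupp (c *: x + y) `|` (msupp x `|` msupp y))%fset.
have ld : (msupp (c *: x + y) `<=` d)%fset by rewrite fsubsetUl.
have ldx : (msupp x `<=` d)%fset by rewrite /d fsetUCA fsubsetUl.
have ldy : (msupp y `<=` d)%fset by rewrite /d fsetUA fsubsetUr.
rewrite (lin_extEw ld) (lin_extEw ldx) (lin_extEw ldy).
rewrite scaler_sumr -big_split /=; apply: eq_bigr => k _.
by rewrite mcoeffD mcoeffZ scalerDl scalerA.
Qed.

HB.instance Definition _ :=
  GRing.isLinear.Build F {malg F[K]} W _ lin_ext lin_ext_is_linear.

End LinearExtension.

Lemma malg_scalerAr (R : comNzRingType) (K : monomType) (c : R)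
  (x y : {malg R[K]}) : c *: (x * y) = x * (c *: y).
Proof.
suff comm : (c%:MP : {malg R[K]}) * x = x * c%:MP.
  by rewrite -!mul_malgC mulrA comm -mulrA.
rewrite mul_malgC; apply/malgP => k.
rewrite mcoeffZ malgM_def fgmulgU raddf_sum /= [in LHS](monalgE x).
rewrite raddf_sum /= mulr_sumr; apply: eq_bigr => l _.
by rewrite mulm1 !mcoeffU mulrnAr mulrC.
Qed.

Section AlgebraQuotient.
Variables (F : fieldType) (A : algType F) (R : A -> Prop).

Definition ideal_gen (t : A) : Prop :=
  exists r s u : A, R s /\ t = r * s * u.

Definition ideal : {pred A} := lspan ideal_gen.

Lemma ideal_mul r s u : s \in ideal -> r * s * u \in ideal.
Proof.
move=> /asboolP sJ; apply/asboolP => P P0 PD PS.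
apply: (sJ (fun s => P (r * s * u))).
- by rewrite mulr0 mul0r.
- move=> c v w Pv Pw; rewrite mulrDr mulrDl -scalerAr -scalerAl.
  exact: PD.
- move=> _ [r' [s' [u' [rel ->]]]]; apply: PS.
  by exists (r * r'), s', (u' * u); rewrite !mulrA.
Qed.

Lemma ideal_ker (B : algType F) (h : {lrmorphism A -> B}) t :
  (forall s, R s -> h s = 0) -> t \in ideal -> h t = 0.
Proof.
move=> h0; apply: lspan_ker => _ [r [s [u [Rs ->]]]].
by rewrite !rmorphM /= (h0 s Rs) mulr0 mul0r.
Qed.

Lemma ideal_proper (B : algType F) (h : {lrmorphism A -> B}) :
  (forall s, R s -> h s = 0) -> 1 \notin ideal.
Proof.
move=> h0; apply/negP => /(ideal_ker h0) /eqP.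
by rewrite rmorph1 oner_eq0.
Qed.

(* Nontriviality is part of the algType interface. *)
Hypothesis proper : 1 \notin ideal.

Definition alg_quot of 1 \notin ideal := lquot ideal_gen.
Local Notation Q := (alg_quot proper).
HB.instance Definition _ := GRing.Lmodule.on Q.

Definition alg_pi (x : A) : Q := lpi ideal_gen x.
HB.instance Definition _ := GRing.isLinear.Build F A Q _ alg_pi
  (@lpi_is_linear F A ideal_gen).

Definition alg_repr (u : Q) : A := repr (u : lquot ideal_gen).

Lemma alg_reprK : cancel alg_repr alg_pi.
Proof. exact: lpi_repr. Qed.

Lemma alg_pi_eq x y : (alg_pi x == alg_pi y) = (x - y \in ideal).
Proof. exact: lpi_eq. Qed.

Lemma alg_repr_pi x : alg_repr (alg_pi x) - x \in ideal.
Proof. by rewrite -alg_pi_eq alg_reprK. Qed.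

Definition alg_mul (u v : Q) : Q := alg_pi (alg_repr u * alg_repr v).

Lemma alg_mulE x y : alg_mul (alg_pi x) (alg_pi y) = alg_pi (x * y).
Proof.
apply/eqP; rewrite alg_pi_eq.
set x' := alg_repr _; set y' := alg_repr _.
have -> : x' * y' - x * y = 1 * (x' - x) * y' + x * (y' - y) * 1.
  by rewrite mul1r mulr1 mulrBl mulrBr addrA subrK.
by rewrite rpredD // ideal_mul // alg_repr_pi.
Qed.

Fact alg_one_neq0 : alg_pi 1 != 0.
Proof. by rewrite -(raddf0 alg_pi) alg_pi_eq subr0. Qed.

Fact alg_mulA : associative alg_mul.
Proof.
move=> x y z; rewrite -[x]alg_reprK -[y]alg_reprK -[z]alg_reprK.
by rewrite !alg_mulE mulrA.
Qed.

Fact alg_mul1 : left_id (alg_pi 1) alg_mul.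
Proof. by move=> x; rewrite -[x]alg_reprK alg_mulE mul1r. Qed.

Fact alg_mulr1 : right_id (alg_pi 1) alg_mul.
Proof. by move=> x; rewrite -[x]alg_reprK alg_mulE mulr1. Qed.

Fact alg_mulDl : left_distributive alg_mul +%R.
Proof.
move=> x y z; rewrite -[x]alg_reprK -[y]alg_reprK -[z]alg_reprK.
by rewrite -raddfD !alg_mulE -raddfD mulrDl.
Qed.

Fact alg_mulDr : right_distributive alg_mul +%R.
Proof.
move=> x y z; rewrite -[x]alg_reprK -[y]alg_reprK -[z]alg_reprK.
by rewrite -raddfD !alg_mulE -raddfD mulrDr.
Qed.

HB.instance Definition _ := GRing.Zmodule_isNzRing.Build Q
  alg_mulA alg_mul1 alg_mulr1 alg_mulDl alg_mulDr alg_one_neq0.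

Lemma alg_piM x y : alg_pi (x * y) = alg_pi x * alg_pi y.
Proof. by rewrite -alg_mulE. Qed.

HB.instance Definition _ := GRing.isMonoidMorphism.Build A Q alg_pi
  (conj (erefl _) alg_piM).

Fact alg_scalerAl (c : F) (x y : Q) : c *: (x * y) = c *: x * y.
Proof.
rewrite -[x]alg_reprK -[y]alg_reprK -alg_piM -!linearZ -alg_piM.
by rewrite /= scalerAl.
Qed.

HB.instance Definition _ := GRing.Lmodule_isLalgebra.Build F Q alg_scalerAl.

Fact alg_scalerAr (c : F) (x y : Q) : c *: (x * y) = x * (c *: y).
Proof.
rewrite -[x]alg_reprK -[y]alg_reprK -alg_piM -!linearZ -alg_piM.
by rewrite /= scalerAr.
Qed.

HB.instance Definition _ := GRing.Lalgebra_isAlgebra.Build F Q alg_scalerAr.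

End AlgebraQuotient.

Definition free_alg (F : fieldType) (T : choiceType) := {malg F[{fmonom T}]}.
HB.instance Definition _ (F : fieldType) (T : choiceType) :=
  GRing.Lalgebra.on (free_alg F T).
HB.instance Definition _ (F : fieldType) (T : choiceType) :=
  GRing.Lalgebra_isAlgebra.Build F (free_alg F T) (@malg_scalerAr F {fmonom T}).

Section FreeAlgebra.
Variables (F : fieldType) (T : choiceType).

Definition free_gen (x : T) : free_alg F T := << fmu x >>.

Variables (A : algType F) (f : T -> A).

Definition free_lift (t : free_alg F T) : A :=
  lin_ext (fun w : {fmonom T} => \prod_(x <- fmonom_val w) f x) t.

HB.instance Definition _ := GRing.isLinear.Build F (free_alg F T) A _
  free_lift (@lin_ext_is_linear _ _ _ _).

Lemma free_lift_gen x : free_lift (free_gen x) = f x.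
Proof. by rewrite /free_lift lin_extU fmU big_seq1. Qed.

Fact free_lift_is_monoid_morphism : monoid_morphism free_lift.
Proof.
split=> [|x y]; first by rewrite /free_lift lin_extU fm1 big_nil.
rewrite /free_lift [x * y]malgME linear_sum /= [in RHS]/lin_ext mulr_suml.
apply: eq_bigr => k _; rewrite linear_sum mulr_sumr /=; apply: eq_bigr => l _.
by rewrite lin_extUZ fmM big_cat /= -scalerAl -scalerAr scalerA.
Qed.

HB.instance Definition _ := GRing.isMonoidMorphism.Build (free_alg F T) A
  free_lift free_lift_is_monoid_morphism.

End FreeAlgebra.

Section GeneralLinear.
Variables (F : fieldType) (m n : nat).
Implicit Types (d e : bool) (X Y : 'M[F]_(m + n)).

(* Parities are booleans, true being odd. *)
Definition mx_part e X : 'M[F]_(m + n) :=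
  if e then block_mx 0 (ursubmx X) (dlsubmx X) 0
  else block_mx (ulsubmx X) 0 0 (drsubmx X).

Definition mx_homog e X := mx_part e X == X.

(* The supercommutator of X of parity d and Y of parity e. *)
Definition scomm d e X Y : 'M[F]_(m + n) :=
  X *m Y - (-1) ^+ (d && e) *: (Y *m X).

(* Z/2-graded Lie subsuperalgebras of gl(m|n). *)
Record lieSuper := LieSuper {
  lie_mem :> {pred 'M[F]_(m + n)};
  _ : submod_closed lie_mem;
  _ : forall e X, X \in lie_mem -> mx_part e X \in lie_mem;
  _ : forall d e X Y, mx_homog d X -> mx_homog e Y ->
        X \in lie_mem -> Y \in lie_mem -> scomm d e X Y \in lie_mem }.

Definition lie_elt (L : lieSuper) := {X : 'M[F]_(m + n) | X \in L}.
HB.instance Definition _ (L : lieSuper) := SubChoice.on (lie_elt L).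

End GeneralLinear.

(* f is linear and carries the superbracket of L to the supercommutator of A,
   the parity in A being the one carried over from L. *)
Definition super_hom (F : fieldType) (m n : nat) (L : lieSuper F m n)
    (A : algType F) (f : lie_elt L -> A) : Prop :=
  (forall (c : F) (x y z : lie_elt L), val z = c *: val x + val y ->
     f z = c *: f x + f y) /\
  (forall (d e : bool) (x y z : lie_elt L),
     mx_homog d (val x) -> mx_homog e (val y) ->
     val z = scomm d e (val x) (val y) ->
     f z = f x * f y - (-1) ^+ (d && e) *: (f y * f x)).

Section Enveloping.
Variables (F : fieldType) (m n : nat) (L : lieSuper F m n).

(* The relators to be killed for g to become a super_hom. *)
Inductive super_rel (A : algType F) (g : lie_elt L -> A) : A -> Prop :=
| SuperLin (c : F) (x y z : lie_elt L) of val z = c *: val x + val y :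
    super_rel g (g z - (c *: g x + g y))
| SuperBracket (d e : bool) (x y z : lie_elt L)
    of mx_homog d (val x) & mx_homog e (val y)
    & val z = scomm d e (val x) (val y) :
    super_rel g (g z - (g x * g y - (-1) ^+ (d && e) *: (g y * g x))).

Lemma super_rel_ker (A B : algType F) (g : lie_elt L -> A)
    (h : {lrmorphism A -> B}) (f : lie_elt L -> B) :
  (forall x, h (g x) = f x) -> super_hom f ->
  forall t, super_rel g t -> h t = 0.
Proof.
move=> hg [f1 f2] t [c x y z zE|d e x y z dx ey zE].
  by rewrite linearB linearP /= !hg (f1 _ _ _ _ zE) subrr.
rewrite linearB /= linearB /= linearZ /= !rmorphM /= !hg.
by rewrite (f2 _ _ _ _ _ dx ey zE) subrr.
Qed.

Lemma super_rel_hom (A B : algType F) (g : lie_elt L -> A)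
    (h : {lrmorphism A -> B}) :
  (forall t, super_rel g t -> h t = 0) -> super_hom (fun x => h (g x)).
Proof.
move=> h0; split=> [c x y z zE|d e x y z dx ey zE]; apply/eqP.
  by rewrite -subr_eq0 -linearP -raddfB /= h0 //; exact: SuperLin.
rewrite -subr_eq0 -!rmorphM -linearZ -!raddfB /= h0 //.
exact: (SuperBracket g dx ey zE).
Qed.

Definition env_rel := super_rel (@free_gen F (lie_elt L)).

Fact env_proper : 1 \notin ideal env_rel.
Proof.
pose f (x : lie_elt L) : F^o := 0.
apply: (@ideal_proper _ _ _ _ (free_lift f)).
apply: (@super_rel_ker _ _ _ _ f) => [x|]; first exact: free_lift_gen.
split=> [c x y z _|d e x y z _ _ _]; rewrite /f.
  by rewrite scaler0 addr0.
by rewrite mulr0 scaler0 subr0.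
Qed.

(* The universal enveloping algebra of L: the tensor algebra of L modulo
   x y - (-1)^(|x||y|) y x - [x, y] for homogeneous x, y. *)
Definition env := alg_quot env_proper.
HB.instance Definition _ := GRing.Algebra.on env.

Definition env_pi : {lrmorphism free_alg F (lie_elt L) -> env} :=
  alg_pi env_proper.
Definition env_repr (u : env) : free_alg F (lie_elt L) :=
  @alg_repr F _ env_rel env_proper u.

Lemma env_reprK u : env_pi (env_repr u) = u.
Proof. exact: alg_reprK. Qed.

Definition env_in (x : lie_elt L) : env := env_pi (free_gen F x).

Lemma env_in_super_hom : super_hom env_in.
Proof.
apply: super_rel_hom => t rt; apply/lpi_eq0/lspan_gen; exists 1, t, 1.
by rewrite mul1r mulr1.
Qed.

(* Products of k homogeneous elements of L, e being the sum of the parities. *)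
Definition env_word (e : bool) (u : env) : Prop :=
  exists s : seq (bool * lie_elt L),
    [/\ all (fun t => mx_homog t.1 (val t.2)) s,
        \big[addb/false]_(t <- s) t.1 = e & u = \prod_(t <- s) env_in t.2].

Definition env_part (e : bool) : {pred env} := lspan (env_word e).

Section Lift.
Variables (A : algType F) (f : lie_elt L -> A).

(* The algebra morphism env -> A extending f, when f is a super_hom. *)
Definition env_lift (u : env) : A := free_lift f (env_repr u).

Hypothesis fP : super_hom f.

Lemma env_lift_pi t : env_lift (env_pi t) = free_lift f t.
Proof.
apply/eqP; rewrite -subr_eq0 /env_lift -raddfB /=; apply/eqP.
apply: (ideal_ker _ (alg_repr_pi _ t)); apply: (@super_rel_ker _ _ _ _ f) => //.
exact: free_lift_gen.
Qed.

Lemma env_lift_in x : env_lift (env_in x) = f x.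
Proof. by rewrite env_lift_pi free_lift_gen. Qed.

Lemma env_liftP (c : F) u v :
  env_lift (c *: u + v) = c *: env_lift u + env_lift v.
Proof.
by rewrite -[u]env_reprK -[v]env_reprK -linearP !env_lift_pi linearP.
Qed.

Lemma env_lift1 : env_lift 1 = 1.
Proof. by rewrite -(rmorph1 env_pi) env_lift_pi rmorph1. Qed.

Lemma env_liftM u v : env_lift (u * v) = env_lift u * env_lift v.
Proof.
by rewrite -[u]env_reprK -[v]env_reprK -rmorphM !env_lift_pi rmorphM.
Qed.

End Lift.
End Enveloping.

Section Tensor.
Variables (F : fieldType) (B A : algType F) (phi : B -> A).
Variables (M : lmodType F) (act : B -> M -> M).

Local Notation pair_space := {malg F[(A * M)%type]}.

Definition pair_gen (a : A) (x : M) : pair_space := << (a, x) >>.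

Inductive tensor_rel : pair_space -> Prop :=
| TensorLinL (c : F) a a' x :
    tensor_rel (pair_gen (c *: a + a') x - (c *: pair_gen a x + pair_gen a' x))
| TensorLinR (c : F) a x x' :
    tensor_rel (pair_gen a (c *: x + x') - (c *: pair_gen a x + pair_gen a x'))
| TensorBalanced a b x :
    tensor_rel (pair_gen (a * phi b) x - pair_gen a (act b x)).

(* The tensor product of A and M over B, where B acts on A by right
   multiplication through phi and on M by act. *)
Definition tensor := lquot tensor_rel.
HB.instance Definition _ := GRing.Lmodule.on tensor.

Definition tens (a : A) (x : M) : tensor := lpi tensor_rel (pair_gen a x).

Definition tensor_act (a : A) (w : tensor) : tensor :=
  lin_ext (fun t : (A * M)%type => tens (a * t.1) t.2) (repr w).

Lemma tens_rel t : tensor_rel t -> lpi tensor_rel t = 0.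
Proof. by move=> rt; apply/lpi_eq0/lspan_gen. Qed.

Lemma tensPl (c : F) a a' x :
  tens (c *: a + a') x = c *: tens a x + tens a' x.
Proof.
apply/eqP; rewrite -subr_eq0 /tens -linearP -raddfB /=.
by rewrite tens_rel //; exact: TensorLinL.
Qed.

Lemma tensPr (c : F) a x x' :
  tens a (c *: x + x') = c *: tens a x + tens a x'.
Proof.
apply/eqP; rewrite -subr_eq0 /tens -linearP -raddfB /=.
by rewrite tens_rel //; exact: TensorLinR.
Qed.

Lemma tens_balanced a b x : tens (a * phi b) x = tens a (act b x).
Proof.
apply/eqP; rewrite -subr_eq0 /tens -raddfB /=.
by rewrite tens_rel //; exact: TensorBalanced.
Qed.

Lemma tensor_act_pi a t : tensor_act a (lpi tensor_rel t) =
  lin_ext (fun u : (A * M)%type => tens (a * u.1) u.2) t.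
Proof.
apply/eqP; rewrite -subr_eq0 /tensor_act -raddfB /=; apply/eqP.
apply: (lspan_ker _ (repr_lpi _ t)) => s /=.
case=> [c b b' x|c b x x'|b b' x]; rewrite raddfB /=.
- rewrite linearP /= /pair_gen !lin_extU /=.
  by rewrite mulrDr -scalerAr tensPl subrr.
- by rewrite linearP /= /pair_gen !lin_extU /= tensPr subrr.
- by rewrite /pair_gen !lin_extU /= mulrA tens_balanced subrr.
Qed.

Lemma tensor_actE a b x : tensor_act a (tens b x) = tens (a * b) x.
Proof. by rewrite /tens tensor_act_pi lin_extU. Qed.

Lemma tensor_actP a (c : F) w w' :
  tensor_act a (c *: w + w') = c *: tensor_act a w + tensor_act a w'.
Proof.
rewrite -[w]lpi_repr -[w']lpi_repr -linearP !tensor_act_pi.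
by rewrite linearP.
Qed.

End Tensor.

Section P2.
Variable F : fieldType.
Implicit Types X Y : 'M[F]_(2 + 2).

Definition p2_mem : {pred 'M[F]_(2 + 2)} := fun X =>
  [&& drsubmx X == - (ulsubmx X)^T, (ursubmx X)^T == ursubmx X
    & (dlsubmx X)^T == - dlsubmx X].

(* g_0 + g_(+1) *)
Definition p2_nonneg_mem : {pred 'M[F]_(2 + 2)} := fun X =>
  p2_mem X && (dlsubmx X == 0).

Lemma p2P X : reflect (exists A B C : 'M[F]_2,
    [/\ X = block_mx A B C (- A^T), B^T = B & C^T = - C]) (X \in p2_mem).
Proof.
apply: (iffP and3P) => [[/eqP D /eqP B /eqP C]|[A [B [C [-> b c]]]]].
  exists (ulsubmx X), (ursubmx X), (dlsubmx X); split=> //.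
  by rewrite -D submxK.
by rewrite block_mxKul block_mxKur block_mxKdl block_mxKdr b c !eqxx.
Qed.

Fact p2_submod : submod_closed p2_mem.
Proof.
split=> [|c X Y /p2P[A [B [C [-> b c1]]]] /p2P[A' [B' [C' [-> b' c']]]]].
  by apply/p2P; exists 0, 0, 0; rewrite !trmx0 !oppr0 block_mx0.
apply/p2P; exists (c *: A + A'), (c *: B + B'), (c *: C + C'); split.
- by rewrite scale_block_mx add_block_mx linearP opprD scalerN.
- by rewrite linearP /= b b'.
- by rewrite linearP /= c1 c' opprD scalerN.
Qed.

Fact p2_graded e X : X \in p2_mem -> mx_part e X \in p2_mem.
Proof.
move=> /p2P[A [B [C [-> b c]]]]; rewrite /mx_part.
rewrite block_mxKul block_mxKur block_mxKdl block_mxKdr.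
apply/p2P; case: e; [exists 0, B, C | exists A, 0, 0];
  by rewrite ?trmx0 ?oppr0.
Qed.

Lemma p2_homogP e X : X \in p2_mem -> mx_homog e X ->
  exists A B C : 'M[F]_2, [/\ X = block_mx A B C (- A^T), B^T = B, C^T = - C
    & if e then A = 0 else B = 0 /\ C = 0].
Proof.
move=> /p2P[A [B [C [-> b c]]]]; rewrite /mx_homog /mx_part.
rewrite block_mxKul block_mxKur block_mxKdl block_mxKdr => /eqP h.
exists A, B, C; split=> //; move: h; case: e => /eq_block_mx[].
  by move=> <-.
by move=> _ <- <-.
Qed.

Fact p2_scomm d e X Y : mx_homog d X -> mx_homog e Y ->
  X \in p2_mem -> Y \in p2_mem -> scomm d e X Y \in p2_mem.
Proof.
move=> dX eY Xp Yp.
have [A [B [C [-> b c z]]]] := p2_homogP Xp dX.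
have [A' [B' [C' [-> b' c' z']]]] := p2_homogP Yp eY.
rewrite /scomm !mulmx_block scale_block_mx opp_block_mx add_block_mx.
apply/and3P; rewrite block_mxKul block_mxKur block_mxKdl block_mxKdr.
case: d e dX eY z z' => [] [] _ _ /=.
- move=> -> ->; rewrite expr1 !scaleN1r !opprK ?trmx0 ?oppr0 ?linear0.
  rewrite !(mul0mx, mulmx0, addr0, add0r) ?trmx0 ?oppr0 ?linear0 ?eqxx.
  by rewrite !linearD /= !trmx_mul b b' c c' !mulNmx ?opprD !opprK addrC eqxx.
- move=> -> [-> ->]; rewrite expr0 !scale1r ?trmx0 ?oppr0 ?linear0.
  rewrite !(mul0mx, mulmx0, addr0, add0r) ?trmx0 ?oppr0 ?linear0 ?eqxx.
  rewrite !linearB /= !trmx_mul !linearN /= !trmxK b c.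
  by split=> //; rewrite ?mulmxN ?mulNmx ?opprK addrC.
- move=> [-> ->] ->; rewrite expr0 !scale1r ?trmx0 ?oppr0 ?linear0.
  rewrite !(mul0mx, mulmx0, addr0, add0r) ?trmx0 ?oppr0 ?linear0 ?eqxx.
  rewrite !linearB /= !trmx_mul !linearN /= !trmxK b' c'.
  by split=> //; rewrite ?mulmxN ?mulNmx ?opprK addrC.
- move=> [-> ->] [-> ->]; rewrite expr0 !scale1r.
  rewrite !(mul0mx, mulmx0, addr0, add0r, subr0) ?trmx0 ?oppr0 ?linear0 ?eqxx.
  by rewrite !linearB /= !trmx_mul !mulmxN !mulNmx !opprK addrC eqxx.
Qed.

Definition p2 := LieSuper p2_submod p2_graded p2_scomm.

Fact p2_nonneg_submod : submod_closed p2_nonneg_mem.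
Proof.
have [p0 pD] := p2_submod; split=> [|c X Y /andP[Xp /eqP X0] /andP[Yp /eqP Y0]].
  apply/andP; split; first exact: p0.
  by rewrite -[X in dlsubmx X]block_mx0 block_mxKdl.
apply/andP; split; first exact: pD.
apply/eqP/matrixP => i j; move/matrixP/(_ i j): X0; move/matrixP/(_ i j): Y0.
by rewrite !mxE => -> ->; rewrite mulr0 addr0.
Qed.

Fact p2_nonneg_graded e X :
  X \in p2_nonneg_mem -> mx_part e X \in p2_nonneg_mem.
Proof.
move=> /andP[Xp /eqP X0]; apply/andP; split; first exact: p2_graded.
by rewrite /mx_part; case: e; rewrite block_mxKdl ?X0.
Qed.

Fact p2_nonneg_scomm d e X Y : mx_homog d X -> mx_homog e Y ->
  X \in p2_nonneg_mem -> Y \in p2_nonneg_mem ->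
  scomm d e X Y \in p2_nonneg_mem.
Proof.
move=> dX eY /andP[Xp /eqP X0] /andP[Yp /eqP Y0].
apply/andP; split; first exact: p2_scomm dX eY Xp Yp.
move/p2P: Xp X0 => [A [B [C [-> _ _]]]]; rewrite block_mxKdl => ->.
move/p2P: Yp Y0 => [A' [B' [C' [-> _ _]]]]; rewrite block_mxKdl => ->.
rewrite /scomm !mulmx_block scale_block_mx opp_block_mx add_block_mx.
rewrite block_mxKdl.
by rewrite !(mul0mx, mulmx0, addr0, scaler0, oppr0).
Qed.

Definition p2_nonneg :=
  LieSuper p2_nonneg_submod p2_nonneg_graded p2_nonneg_scomm.

Definition p2_incl (x : lie_elt p2_nonneg) : lie_elt p2 :=
  Sub (val x) (proj1 (andP (valP x))).

(* The matrix unit e_ij, with the 1-based indices of the matrices in gl(2|2). *)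
Definition mx_unit (i j : nat) : 'M[F]_(2 + 2) :=
  delta_mx (inord i.-1) (inord j.-1).

Definition gamma_mx := mx_unit 4 1 - mx_unit 3 2.
Definition h1_mx := mx_unit 3 3 - mx_unit 1 1.
Definition h2_mx := mx_unit 4 4 - mx_unit 2 2.
Definition alpha_mx := mx_unit 4 3 - mx_unit 1 2.
Definition beta_mx := mx_unit 3 4 - mx_unit 2 1.

Let ord2P (P : 'I_2 -> Prop) : P 0 -> P 1 -> forall i, P i.
Proof.
move=> P0 P1 [[|[|//]] ilt]; [rewrite (_ : Ordinal ilt = 0) // | ];
  last rewrite (_ : Ordinal ilt = 1) //; exact: val_inj.
Qed.

Let p2_memE X :
  (forall i j : 'I_2, X (rshift 2 i) (rshift 2 j) = - X (lshift 2 j) (lshift 2 i)) ->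
  (forall i j : 'I_2, X (lshift 2 j) (rshift 2 i) = X (lshift 2 i) (rshift 2 j)) ->
  (forall i j : 'I_2, X (rshift 2 j) (lshift 2 i) = - X (rshift 2 i) (lshift 2 j)) ->
  X \in p2_mem.
Proof.
by move=> a b c; apply/and3P; split; apply/eqP/matrixP => i j; rewrite !mxE.
Qed.

Ltac p2_elt := apply: p2_memE;
  (apply: ord2P; apply: ord2P); rewrite !mxE -!val_eqE /= !inordK //=;
  rewrite ?(subr0, sub0r, oppr0, opprK, addr0, add0r, subrr).

Fact gamma_mem : gamma_mx \in p2. Proof. by p2_elt. Qed.
Fact h1_mem : h1_mx \in p2. Proof. by p2_elt. Qed.
Fact h2_mem : h2_mx \in p2. Proof. by p2_elt. Qed.

Definition gamma : lie_elt p2 := Sub gamma_mx gamma_mem.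
Definition h1 : lie_elt p2 := Sub h1_mx h1_mem.
Definition h2 : lie_elt p2 := Sub h2_mx h2_mem.

End P2.


Section KacModule.
Variables (F : fieldType) (p : nat).

Definition Phi (c : 'F_p) : nat := c.

(* The embedding of the prime field, a morphism when F has characteristic p. *)
Definition ofFp (c : 'F_p) : F := (Phi c)%:R.

Variables a b : 'F_p.
Local Notation N := (Phi (b - a)).+1.

(* Matrices acting on column vectors: column k is the image of v_k. *)
Definition kac_h1 : 'M[F]_N := diag_mx (\row_k (ofFp a + k%:R)).
Definition kac_h2 : 'M[F]_N := diag_mx (\row_k (ofFp b - k%:R)).
Definition kac_alpha : 'M[F]_N := \matrix_(i, k)
  if i.+1 == k :> nat then k%:R * (ofFp b - ofFp a - k%:R + 1) else 0.
Definition kac_beta : 'M[F]_N := \matrix_(i, k) (i == k.+1 :> nat)%:R.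

(* The g_0-component of x is D_00 h1 + D_11 h2 + D_10 alpha + D_01 beta, where
   D is the lower right block of x; the g_(+1)-component acts by zero. *)
Definition kac_rep (x : lie_elt (p2_nonneg F)) : 'M[F]_N :=
  let D := drsubmx (val x) in
  D 0 0 *: kac_h1 + D 1 1 *: kac_h2 + D 1 0 *: kac_alpha + D 0 1 *: kac_beta.

Lemma kac_rep_basis :
  [/\ forall x, val x = h1_mx F -> kac_rep x = kac_h1,
      forall x, val x = h2_mx F -> kac_rep x = kac_h2,
      forall x, val x = alpha_mx F -> kac_rep x = kac_alpha,
      forall x, val x = beta_mx F -> kac_rep x = kac_beta
    & forall x, mx_homog true (val x) -> kac_rep x = 0].
Proof.
split=> x xE; rewrite /kac_rep.
1-4: rewrite xE !mxE -!val_eqE /= !inordK //=.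
1-4: by rewrite !(subr0, scale0r, scale1r, addr0, add0r).
rewrite -(eqP xE) /= block_mxKdr !mxE.
by rewrite !scale0r !addr0.
Qed.

Lemma ofFpD x y : p \in [pchar F] -> ofFp (x + y) = ofFp x + ofFp y.
Proof.
move=> pF; have p_pr := pcharf_prime pF.
rewrite -natrD /ofFp /Phi /= [X in (_ %% X)%N]Fp_cast //.
by rewrite [in RHS](divn_eq (x + y) p) natrD natrM (pcharf0 pF) mulr0 add0r.
Qed.

Section KacRelations.
Hypothesis pF : p \in [pchar F].

Let nE : ofFp b - ofFp a = (Phi (b - a))%:R.
Proof. by apply/eqP; rewrite subr_eq -ofFpD // subrK. Qed.

Let h12 : kac_h2 *m kac_h1 = kac_h1 *m kac_h2.
Proof. exact: diag_mxC. Qed.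

Let h1al : kac_alpha *m kac_h1 = kac_h1 *m kac_alpha + kac_alpha.
Proof.
rewrite mul_mx_diag mul_diag_mx; apply/matrixP => i j; rewrite !mxE.
by case: eqP => [<-|_]; rewrite ?mulr0n -?natr1; ring.
Qed.

Let h1be : kac_beta *m kac_h1 = kac_h1 *m kac_beta - kac_beta.
Proof.
rewrite mul_mx_diag mul_diag_mx; apply/matrixP => i j; rewrite !mxE.
by case: eqP => [->|_]; rewrite ?mulr0n -?natr1; ring.
Qed.

Let h2al : kac_alpha *m kac_h2 = kac_h2 *m kac_alpha - kac_alpha.
Proof.
rewrite mul_mx_diag mul_diag_mx; apply/matrixP => i j; rewrite !mxE.
by case: eqP => [<-|_]; rewrite ?mulr0n -?natr1; ring.
Qed.

Let h2be : kac_beta *m kac_h2 = kac_h2 *m kac_beta + kac_beta.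
Proof.
rewrite mul_mx_diag mul_diag_mx; apply/matrixP => i j; rewrite !mxE.
by case: eqP => [->|_]; rewrite ?mulr0n -?natr1; ring.
Qed.

Let alE (i j : 'I_N) : (kac_alpha *m kac_beta) i j =
  ((i == j) : nat)%:R * (i.+1%:R * (ofFp b - ofFp a - i.+1%:R + 1)).
Proof.
rewrite mxE; case: (ltnP i.+1 N) => iN.
  rewrite (bigD1 (Ordinal iN)) //= !mxE /= eqxx big1 ?addr0.
    by rewrite eqSS mulrC.
  move=> k; rewrite -val_eqE /= => kN; rewrite !mxE eq_sym (negPf kN).
  by rewrite mul0r.
have -> : i = N.-1 :> nat by apply/eqP; rewrite eqn_leq -ltnS ltn_ord.
rewrite big1 => [|k _].
  by rewrite nE -natr1; ring.
rewrite !mxE; case: eqP => [kE|]; last by rewrite mul0r.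
by have := ltn_ord k; rewrite -kE ltnNge iN.
Qed.

Let beE (i j : 'I_N) : (kac_beta *m kac_alpha) i j =
  ((i == j) : nat)%:R * (i%:R * (ofFp b - ofFp a - i%:R + 1)).
Proof.
rewrite mxE; case: (posnP i) => i0.
  rewrite i0 mul0r mulr0 big1 // => k _; by rewrite !mxE i0 mul0r.
have iN : (i.-1 < N)%N by rewrite (leq_ltn_trans (leq_pred i)).
rewrite (bigD1 (Ordinal iN)) //= !mxE /= prednK // eqxx mul1r big1 ?addr0.
  by rewrite -val_eqE /=; case: eqP => [->|_]; rewrite ?mul1r ?mul0r.
move=> k; rewrite -val_eqE /= => kN; rewrite !mxE.
case: (@eqP _ (i : nat)) kN => [->|_ _]; last by rewrite mul0r.
by rewrite /= eqxx.
Qed.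

Let alb : kac_beta *m kac_alpha = kac_alpha *m kac_beta - kac_h2 + kac_h1.
Proof.
apply/matrixP => i j; rewrite beE mxE mxE alE !mxE; case: eqP => [->|_].
  by rewrite -natr1 /=; ring.
by rewrite /=; ring.
Qed.

Let mulmx2E (P Q : 'M[F]_2) i j :
  (P *m Q) i j = P i 0 * Q 0 j + P i 1 * Q 1 j.
Proof.
rewrite mxE big_ord_recl big_ord1.
by rewrite (_ : lift ord0 ord0 = 1) //; exact: val_inj.
Qed.

Let dr_scomm d e (x y z : lie_elt (p2_nonneg F)) :
  val z = scomm d e (val x) (val y) ->
  drsubmx (val z) = drsubmx (val x) *m drsubmx (val y)
    - (-1) ^+ (d && e) *: (drsubmx (val y) *m drsubmx (val x)).
Proof.
have := valP x; have := valP y => /andP[_ /eqP y0] /andP[_ /eqP x0] ->.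
rewrite /scomm -[val x in LHS]submxK -[val y in LHS]submxK x0 y0.
rewrite !mulmx_block scale_block_mx opp_block_mx add_block_mx block_mxKdr.
by rewrite !mul0mx !add0r.
Qed.

Let dr_odd (x : lie_elt (p2_nonneg F)) :
  mx_homog true (val x) -> drsubmx (val x) = 0.
Proof. by move=> /eqP <-; rewrite /= block_mxKdr. Qed.

Let rep_dr0 (x : lie_elt (p2_nonneg F)) :
  drsubmx (val x) = 0 -> kac_rep x = 0.
Proof. by move=> x0; rewrite /kac_rep x0 !mxE !scale0r !addr0. Qed.

Lemma kac_rep_super_hom : super_hom kac_rep.
Proof.
split=> [c x y z zE|d e x y z dx ey /dr_scomm].
  rewrite /kac_rep zE !mxE.
  move: kac_h1 kac_h2 kac_alpha kac_beta => H1 H2 U V.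
  by apply/matrixP => i j; rewrite !mxE; ring.
case: d dx => [/dr_odd x0|_].
  rewrite x0 mul0mx mulmx0 scaler0 subr0 => /rep_dr0 ->.
  by rewrite (rep_dr0 x0) mul0r mulr0 scaler0 subr0.
case: e ey => [/dr_odd y0|_].
  rewrite y0 mul0mx mulmx0 scaler0 subr0 => /rep_dr0 ->.
  by rewrite (rep_dr0 y0) mul0r mulr0 scaler0 subr0.
rewrite !scale1r /kac_rep => ->.
move: (drsubmx (val x)) (drsubmx (val y)) => P Q.
rewrite ![(_ - _ : 'M_2) _ _]mxE ![(- _ : 'M_2) _ _]mxE !mulmx2E.
rewrite -![_ * _ : 'M_N]/(_ *m _).
rewrite !(mulmxDl, mulmxDr) -!scalemxAl -!scalemxAr.
rewrite h12 h1al h1be h2al h2be alb.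
move: kac_h1 kac_h2 kac_alpha kac_beta => H1 H2 U V.
move: (H1 *m H1) (H1 *m H2) (H1 *m U) (H1 *m V) (H2 *m H2) (H2 *m U).
move=> M11 M12 M1U M1V M22 M2U.
move: (H2 *m V) (U *m U) (U *m V) (V *m V) => M2V MUU MUV MVV.
by apply/matrixP => i j; rewrite !mxE; ring.
Qed.

End KacRelations.

Definition kac_M := 'cV[F]_N.
HB.instance Definition _ := GRing.Lmodule.on kac_M.

Definition kac_v (k : 'I_N) : kac_M := delta_mx k 0.

Definition kac_M_act (u : env (p2_nonneg F)) (x : kac_M) : kac_M :=
  env_lift kac_rep u *m x.

Definition env_incl (u : env (p2_nonneg F)) : env (p2 F) :=
  env_lift (fun x => env_in (p2_incl x)) u.

Lemma env_incl_super_hom :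
  super_hom (fun x : lie_elt (p2_nonneg F) => env_in (p2_incl x)).
Proof.
have [lin br] := @env_in_super_hom F 2 2 (p2 F).
by split=> *; [apply: lin | apply: br].
Qed.

Definition kac := tensor env_incl kac_M_act.
HB.instance Definition _ := GRing.Lmodule.on kac.

Definition kac_tens (u : env (p2 F)) (x : kac_M) : kac :=
  tens env_incl kac_M_act u x.

Definition kac_act (x : lie_elt (p2 F)) (w : kac) : kac :=
  @tensor_act _ _ _ env_incl _ kac_M_act (env_in x) w.

(* M(lambda) is purely even. *)
Definition kac_part (e : bool) : {pred kac} :=
  lspan (fun w => exists u x, u \in env_part e /\ w = kac_tens u x).

Definition kac_weight (i j : int) (w : kac) : Prop :=
  kac_act (h1 F) w = i%:~R *: w /\ kac_act (h2 F) w = j%:~R *: w.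

(* W is the graded space < x | y >. *)
Definition is_graded_span (W : kac -> Prop) (x y : kac) : Prop :=
  [/\ x \in kac_part false, y \in kac_part true
    & forall w, W w <-> exists c d : F, w = c *: x + d *: y].

(* W = < 1 (x) v_k | 0 >, W = < 0 | gamma (x) v_k > and W = < 0 | 0 >; the
   first two include k <= Phi (b - a), so that v_k is a basis vector. *)
Definition is_even_line (W : kac -> Prop) (k : nat) : Prop :=
  exists2 k' : 'I_N, k' = k :> nat
    & is_graded_span W (kac_tens 1 (kac_v k')) 0.
Definition is_odd_line (W : kac -> Prop) (k : nat) : Prop :=
  exists2 k' : 'I_N, k' = k :> nat
    & is_graded_span W 0 (kac_tens (env_in (gamma F)) (kac_v k')).
Definition is_zero (W : kac -> Prop) : Prop := is_graded_span W 0 0.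

End KacModule.

Definition in_range (c d x : int) : bool := (c <= x <= d)%R.

(* W is < 1 (x) v_k1 | 0 > in case c1, < 0 | gamma (x) v_k2 > in case c2, and
   zero otherwise. *)
Definition weight_cases (F : fieldType) (p : nat) (a b : 'F_p)
    (W : kac F a b -> Prop) (c1 : bool) (k1 : nat) (c2 : bool) (k2 : nat) :=
  [/\ c1 -> is_even_line W k1, c2 -> is_odd_line W k2
    & ~~ c1 && ~~ c2 -> is_zero W].

(* Main.v *)
From HB Require Import structures.
Require Import Defs.
From mathcomp Require Import all_boot all_order all_algebra.
From mathcomp Require Import boolp monalg zify ring.

Set Implicit Arguments.
Unset Strict Implicit.
Unset Printing Implicit Defensive.

Import GRing.Theory.
Local Open Scope ring_scope.

(* Since gamma^2 = 0 and gamma together with g_0 + g_(+1) spans g, K(lambda) is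
   spanned by the 1 (x) v_k and gamma (x) v_k. These are weight vectors, so each
   weight space is spanned by those of its own weight. Comparing weights, such a
   vector is 1 (x) v_k with a + b = i + j and k = b - j, or gamma (x) v_k with
   a + b = i + j - 2 and k = b + 1 - j, subject to k <= Phi (b - a). The listed
   ranges for Phi b spell out this last inequality of residues mod p. Linear
   independence of the spanning vectors (PBW) plays no role. *)

(** * Induction principles for free modules, enveloping algebras and tensor products *)

Lemma malg_ind (F : fieldType) (K : choiceType) (P : {malg F[K]} -> Prop) :
  P 0 -> (forall c u v, P u -> P v -> P (c *: u + v)) ->
  (forall k, P << k >>) -> forall t, P t.
Proof.
move=> P0 PD Pk t; rewrite [t]monalgE.
elim/big_rec: _ => [//|k u _ Pu].
suff -> : << t@_k *g k >> = t@_k *: << k >> by apply: PD.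
by apply/malgP => l; rewrite mcoeffZ !mcoeffU mulrnAr mulr1.
Qed.

(** Every element is the class of a combination of words, and a word is peeled off one letter at a
    time from the left. Left multiplication is the form that matches the action on the left tensor
    factor of [kac]. *)
Lemma env_ind (F : fieldType) m n (L : lieSuper F m n) (P : env L -> Prop) :
  (forall c u v, P u -> P v -> P (c *: u + v)) -> P 1 ->
  (forall x u, P u -> P (env_in x * u)) -> forall u, P u.
Proof.
move=> PD P1 PM u; rewrite -[u]env_reprK.
elim/malg_ind: (env_repr u) => [|c t t' Pt Pt'|[w]].
(* There is no hypothesis for 0, so it is reached as [-1 *: 1 + 1]. *)
- by rewrite raddf0 -(addNr 1) -scaleN1r; apply: PD.
- by rewrite linearP; apply: PD.
elim: w => [|x w IHw].
  suff -> : env_pi L << FMonom [::] >> = 1 by [].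
  by rewrite -(rmorph1 (env_pi L)); congr (env_pi L << _ >>); apply: val_inj; rewrite /= fm1.
have -> : << FMonom (x :: w) >> = free_gen F x * << FMonom w >> :> free_alg F _.
  rewrite /free_gen [RHS]malgM_def fgmulUU mulr1; congr << _ >>; apply: val_inj.
  by rewrite /= fmM fmU.
by rewrite rmorphM; apply: PM.
Qed.

Lemma tensor_ind (F : fieldType) (B A : algType F) (phi : B -> A)
    (M : lmodType F) (act : B -> M -> M) (P : tensor phi act -> Prop) :
  P 0 -> (forall c u v, P u -> P v -> P (c *: u + v)) ->
  (forall a x, P (tens phi act a x)) -> forall w, P w.
Proof.
move=> P0 PD Pt w; rewrite -[w]lpi_repr.
elim/malg_ind: (repr w) => [|c t t' Pu Pu'|[u x]]; last exact: Pt.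
  by rewrite raddf0.
by rewrite linearP; apply: PD.
Qed.

(* The role of t is played by [kac_tens]; with t abstract, unification cannot
   unfold the quotients that define it. *)
Section TwoTermSpan.
Variables (F : fieldType) (A : algType F) (M W : lmodType F).
Variables (t : A -> M -> W) (g : A).
Hypothesis tP : forall u, linear (t u).

Definition two_span (w : W) : Prop := exists y z, w = t 1 y + t g z.

Let tZ u c y : t u (c *: y) = c *: t u y.
Proof.
have t0 : t u 0 = 0 by rewrite -(addNr 0) -scaleN1r tP scaleN1r addNr.
by rewrite -[c *: y]addr0 tP t0 addr0.
Qed.

Lemma two_span_lin c u v : two_span u -> two_span v -> two_span (c *: u + v).
Proof.
move=> [y [z ->]] [y' [z' ->]]; exists (c *: y + y'), (c *: z + z').
by rewrite !tP scalerDr addrACA.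
Qed.

Lemma two_span1 y : two_span (t 1 y).
Proof. by exists y, 0; rewrite -(scale0r 0) tZ scale0r addr0. Qed.

Lemma two_span2 y : two_span (t g y).
Proof. by exists 0, y; rewrite -(scale0r 0) tZ scale0r add0r. Qed.

(** With [f] the action of [x], stability of the span is reduced to the products [x] and [x * g].
    This is the inductive step of [kac_spanned]. *)
Lemma two_span_act (f : W -> W) x w : (forall c, {morph f : u v / c *: u + v}) ->
  (forall u y, f (t u y) = t (x * u) y) ->
  (forall y, two_span (t x y)) -> (forall y, two_span (t (x * g) y)) ->
  two_span w -> two_span (f w).
Proof.
move=> fP ft t1 tg [y [z ->]]; rewrite -[t 1 y]scale1r fP !ft mulr1.
exact: two_span_lin.
Qed.

End TwoTermSpan.

(** * Spanning of K(lambda) by the vectors 1 (x) y and gamma (x) y *)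

Section KacSpan.
Variables (F : fieldType) (p : nat) (charF : p \in [pchar F]).
Hypothesis p_gt2 : (2 < p)%N.
Variables a b : 'F_p.
Local Notation g := (env_in (gamma F)).
Local Notation tens := (@kac_tens F p a b).
Local Notation M := (kac_M F a b).

Lemma two_neq0 : 2%:R != 0 :> F.
Proof. by rewrite -(dvdn_pcharf charF); apply/negP => /dvdn_leq -/(_ isT); lia. Qed.

Lemma lie_scomm d e (x y : lie_elt (p2 F)) :
  mx_homog d (val x) -> mx_homog e (val y) ->
  exists z : lie_elt (p2 F), val z = scomm d e (val x) (val y).
Proof.
move=> dx ey; have mem : scomm d e (val x) (val y) \in p2 F.
  by apply: p2_scomm => //; apply: valP.
by exists (Sub (scomm d e (val x) (val y)) mem).
Qed.

Lemma gamma_homog : mx_homog true (val (gamma F)).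
Proof.
apply/eqP; rewrite -[RHS]submxK /=; congr block_mx; apply/matrixP => i j.
  rewrite !mxE -!val_eqE /= !inordK //=.
  by case: i j => [[|[|]]] // ? [[|[|]]]; rewrite //= subrr.
rewrite !mxE -!val_eqE /= !inordK //=.
by case: i j => [[|[|]]] // ? [[|[|]]]; rewrite //= subrr.
Qed.

(** The lower left block of [x] is a skew 2 by 2 matrix, hence a multiple of the block of gamma,
    which has entry 1 at (1, 0); that entry of [x] is the coefficient [c]. *)
Lemma lie_gamma_split (x : lie_elt (p2 F)) :
  exists c (n : lie_elt (p2_nonneg F)),
    val x = c *: val (gamma F) + val (p2_incl n).
Proof.
pose c := (dlsubmx (val x)) 1 0.
have mem : val x - c *: val (gamma F) \in p2_nonneg F.
  have [_ cl] := p2_submod F.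
  apply/andP; split.
    by rewrite addrC -scaleNr; apply: cl; apply: valP.
  have /and3P[_ _ /eqP xC] := valP x.
  have C i j : dlsubmx (val x) i j = - dlsubmx (val x) j i.
    by move/matrixP/(_ j i): xC; rewrite !mxE.
  have C0 i : dlsubmx (val x) i i = 0.
    (* Skewness only gives that twice a diagonal entry is 0; the characteristic is not 2. *)
    apply/eqP; have /eqP := C i i; rewrite -addr_eq0 -mulr2n -mulr_natl mulf_eq0.
    by rewrite (negPf two_neq0).
  apply/eqP/matrixP => i j.
  have -> : dlsubmx (val x - c *: val (gamma F)) i j =
      dlsubmx (val x) i j - c * dlsubmx (val (gamma F)) i j.
    by rewrite !mxE.
  have -> : dlsubmx (val (gamma F)) i j = (i == 1)%:R * (j == 0)%:R - (i == 0)%:R * (j == 1)%:R.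
    rewrite !mxE -!val_eqE /= !inordK //=.
    by case: i j => [[|[|]]] // ? [[|[|]]] //= ?; ring.
  rewrite [RHS]mxE /c.
  have i2P (k : 'I_2) : k = 0 \/ k = 1.
    by case: k => [[|[|]]] // h; [left | right]; apply: val_inj.
  case: (i2P i) (i2P j) => -> [] ->; rewrite ?C0 ?eqxx /=; try ring.
  by rewrite [X in X - _]C; ring.
by exists c, (Sub (val x - c *: val (gamma F)) mem); rewrite /p2_incl /= addrC subrK.
Qed.

(** As gamma is odd, its bracket with itself is 2 gamma^2, both in the enveloping algebra and for
    matrices. The matrix gamma squares to 0, and 2 is invertible. *)
Lemma gamma_sq : g * g = 0.
Proof.
have [z zE] := lie_scomm gamma_homog gamma_homog.
have [lin br] := @env_in_super_hom F 2 2 (p2 F).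
have z0 : val z = 0.
  rewrite zE /scomm expr1 scaleN1r opprK -mulr2n.
  suff -> : val (gamma F) *m val (gamma F) = 0 by rewrite mul0rn.
  rewrite -(eqP gamma_homog) /= mulmx_block !(mul0mx, mulmx0, add0r, addr0).
  have -> : ursubmx (val (gamma F)) = 0.
    apply/matrixP => i j; rewrite !mxE -!val_eqE /= !inordK //=.
    by case: i j => [[|[|]]] // ? [[|[|]]]; rewrite //= subrr.
  by rewrite mul0mx mulmx0 -[RHS](@block_mx0 _ 2 2 2 2).
have : env_in z = 0.
  (* [super_hom] has a single linearity clause, so [env_in z = 0] is drawn from it by writing the
     zero matrix as [-1 *: z + z]. *)
  have zz : val z = -1 *: val z + val z by rewrite z0 scaler0 addr0.
  by rewrite (lin _ _ _ _ zz) scaleN1r addNr.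
rewrite (br _ _ _ _ _ gamma_homog gamma_homog zE) /= expr1 scaleN1r opprK.
move/eqP; rewrite -mulr2n -scaler_nat scaler_eq0 (negPf two_neq0) /=.
by move/eqP.
Qed.

Definition kac_gen : kac F a b -> Prop := two_span tens g.

Lemma kac_tensDl u v y : tens (u + v) y = tens u y + tens v y.
Proof. by rewrite -[u in LHS]scale1r /kac_tens tensPl scale1r. Qed.

Lemma kac_tensDr u y z : tens u (y + z) = tens u y + tens u z.
Proof. by rewrite -[y in LHS]scale1r /kac_tens tensPr scale1r. Qed.

Lemma kac_tens0r u : tens u 0 = 0.
Proof. by rewrite -(addNr 0) -scaleN1r /kac_tens tensPr scaleN1r addNr. Qed.

Lemma kac_tens0l y : tens 0 y = 0.
Proof. by rewrite -(addNr 0) -scaleN1r /kac_tens tensPl scaleN1r addNr. Qed.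

Lemma kac_tensZl c u y : tens (c *: u) y = c *: tens u y.
Proof. by rewrite -[c *: u]addr0 /kac_tens tensPl [X in _ + X]kac_tens0l addr0. Qed.

Lemma kac_tensZr c u y : tens u (c *: y) = c *: tens u y.
Proof. by rewrite -[c *: y]addr0 /kac_tens tensPr [X in _ + X]kac_tens0r addr0. Qed.

(** This is the balancing relation on a generator: elements of g_0 + g_(+1) cross the tensor sign
    and act through [kac_rep], which is a representation because F has characteristic p. *)
Lemma kac_tensB u (n : lie_elt (p2_nonneg F)) y :
  tens (u * env_in (p2_incl n)) y = tens u (kac_rep a b n *m y).
Proof.
have <- : env_incl (env_in n) = env_in (p2_incl n).
  by rewrite /env_incl (env_lift_in (env_incl_super_hom F)).
rewrite /kac_tens tens_balanced /kac_M_act (env_lift_in (kac_rep_super_hom a b charF)) //.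
Qed.

Lemma kac_act_tens x u y : kac_act x (tens u y) = tens (env_in x * u) y.
Proof. exact: tensor_actE. Qed.

Lemma kac_actP x c (u v : kac F a b) :
  kac_act x (c *: u + v) = c *: kac_act x u + kac_act x v.
Proof. exact: tensor_actP. Qed.

Lemma kac_ind (P : kac F a b -> Prop) :
  P 0 -> (forall c u v, P u -> P v -> P (c *: u + v)) ->
  (forall u x, P (tens u x)) -> forall w, P w.
Proof. exact: tensor_ind. Qed.

Let tens_lin u : linear (tens u).
Proof. by move=> c y z; exact: tensPr. Qed.

Lemma kac_gen_lin c u v : kac_gen u -> kac_gen v -> kac_gen (c *: u + v).
Proof. exact: (two_span_lin tens_lin). Qed.

Lemma kac_gen1 y : kac_gen (tens 1 y).
Proof. exact: (two_span1 g tens_lin). Qed.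

Lemma kac_geng y : kac_gen (tens g y).
Proof. exact: (two_span2 g tens_lin). Qed.

Lemma env_in_split (x : lie_elt (p2 F)) : exists c n,
  env_in x = c *: g + env_in (p2_incl n).
Proof.
have [c [n xE]] := lie_gamma_split x; exists c, n.
by have [lin _] := @env_in_super_hom F 2 2 (p2 F); apply: lin.
Qed.

Lemma kac_gen_env_in (x : lie_elt (p2 F)) y : kac_gen (tens (env_in x) y).
Proof.
have [c [n ->]] := env_in_split x; rewrite kac_tensDl kac_tensZl.
apply: kac_gen_lin; first exact: kac_geng.
by rewrite -[env_in (p2_incl n)]mul1r kac_tensB; apply: kac_gen1.
Qed.

Lemma nonneg_homog_split (n : lie_elt (p2_nonneg F)) :
  exists n0 n1 : lie_elt (p2_nonneg F),
    [/\ mx_homog false (val n0), mx_homog true (val n1) & val n = val n0 + val n1].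
Proof.
pose q e : lie_elt (p2_nonneg F) := Sub (mx_part e (val n)) (p2_nonneg_graded e (valP n)).
exists (q false), (q true); rewrite /q /= /mx_homog /mx_part.
rewrite !(block_mxKul, block_mxKur, block_mxKdl, block_mxKdr) !eqxx; split=> //.
by rewrite add_block_mx !addr0 !add0r submxK.
Qed.

(** For homogeneous [n], n gamma is the bracket [n, gamma] plus or minus gamma n. The bracket lies
    in g, so [kac_gen_env_in] applies to it, and in gamma n the factor n crosses the tensor sign.
    The bracket relation requires homogeneity, hence the splitting of [n] into its even and odd
    parts. *)
Lemma kac_gen_mul_gamma (n : lie_elt (p2_nonneg F)) y :
  kac_gen (tens (env_in (p2_incl n) * g) y).
Proof.
have [lin br] := @env_in_super_hom F 2 2 (p2 F).
have step e (m : lie_elt (p2_nonneg F)) : mx_homog e (val m) ->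
    kac_gen (tens (env_in (p2_incl m) * g) y).
  move=> em; have em' : mx_homog e (val (p2_incl m)) by [].
  have [z zE] := lie_scomm em' gamma_homog.
  have /(canRL (subrK _)) -> := esym (br _ _ _ _ _ em' gamma_homog zE).
  rewrite addrC kac_tensDl kac_tensZl.
  apply: kac_gen_lin; last exact: kac_gen_env_in.
  by rewrite kac_tensB; apply: kac_geng.
have [n0 [n1 [h0 h1 nE]]] := nonneg_homog_split n.
have -> : env_in (p2_incl n) = env_in (p2_incl n0) + env_in (p2_incl n1).
  rewrite -[env_in (p2_incl n0)]scale1r; apply: lin.
  by rewrite scale1r.
rewrite mulrDl kac_tensDl -[X in kac_gen (X + _)]scale1r.
by apply: kac_gen_lin; [apply: step h0 | apply: step h1].
Qed.

(** Induction on the left tensor factor. A new letter is c gamma + n with n in g_0 + g_(+1); on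
    gamma (x) z the first term vanishes since gamma^2 = 0, and the second is [kac_gen_mul_gamma]. *)
Lemma kac_spanned w : kac_gen w.
Proof.
elim/kac_ind: w => [|c u v|u x]; last 1 first.
- elim/env_ind: u x => [c u v IHu IHv x| x | x u IHu y].
  + by rewrite kac_tensDl kac_tensZl; apply: kac_gen_lin.
  + exact: kac_gen1.
  rewrite -kac_act_tens.
  apply: (@two_span_act _ _ _ _ tens g tens_lin (kac_act x) (env_in x)) (IHu y).
  + exact: kac_actP.
  + exact: kac_act_tens.
  + exact: kac_gen_env_in.
  move=> z; have [c [n ->]] := env_in_split x.
  rewrite mulrDl -scalerAl gamma_sq scaler0 add0r.
  exact: kac_gen_mul_gamma.
- by rewrite -(kac_tens0r 1); apply: kac_gen1.
exact: kac_gen_lin.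
Qed.

End KacSpan.

(** * Weight vectors of a family of linear operators *)

Section WeightVectors.
Variables (F : fieldType) (V : lmodType F) (J : Type) (h : J -> {linear V -> V}).

Definition weight_vec (mu : J -> F) (x : V) := forall j, h j x = mu j *: x.

Lemma weight_vecZ mu c x : weight_vec mu x -> weight_vec mu (c *: x).
Proof. by move=> mx j; rewrite linearZ_LR mx !scalerA mulrC. Qed.

Lemma weight_vecB mu x y :
  weight_vec mu x -> weight_vec mu y -> weight_vec mu (x - y).
Proof. by move=> mx my j; rewrite linearB mx my scalerBr. Qed.

Lemma weight_vec_sum mu (I : Type) (s : seq I) (P : pred I) (w : I -> V) :
  (forall k, P k -> weight_vec mu (w k)) -> weight_vec mu (\sum_(k <- s | P k) w k).
Proof.
move=> wmu j; rewrite linear_sum scaler_sumr.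
by apply: eq_bigr => k Pk; apply: wmu.
Qed.

(** Separation of eigenvectors: for a [j] with [nu k j != mu j], the operator h_j - nu_k(j) kills
    the k-th summand, rescales the others, and multiplies [x] by the nonzero scalar [mu j - nu k j].
    Induction then applies to the shorter sum. The weights [nu] may repeat. *)
Lemma weight_vec_indep (I : Type) (s : seq I) (P : pred I) (nu : I -> J -> F) mu w x :
  (forall k, P k -> weight_vec (nu k) (w k)) ->
  (forall k, P k -> exists j, nu k j != mu j) ->
  weight_vec mu x -> x = \sum_(k <- s | P k) w k -> x = 0.
Proof.
elim: s w x => [|k s IHs] w x wnu nun mx; first by rewrite big_nil.
rewrite big_cons; case: ifP => [Pk xE|_]; last exact: IHs mx.
have [j nj] := nun _ Pk.
have : (mu j - nu k j) *: x = 0.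
  apply: (IHs (fun l => (nu l j - nu k j) *: w l)) => //.
  - by move=> l Pl; apply/weight_vecZ/wnu.
  - exact: weight_vecZ.
  rewrite scalerBl -mx xE linearD scalerDr (wnu k Pk) opprD addrACA subrr add0r.
  rewrite linear_sum scaler_sumr -sumrB; apply: eq_bigr => l Pl.
  by rewrite wnu // scalerBl.
by move/eqP; rewrite scaler_eq0 subr_eq0 eq_sym (negPf nj) => /eqP.
Qed.

(** The difference of the two sums has weight [mu] and is a sum of vectors of other weights, hence
    is 0. *)
Lemma weight_vec_proj (I : finType) (nu : I -> J -> F) mu w :
  (forall k, weight_vec (nu k) (w k)) -> weight_vec mu (\sum_k w k) ->
  \sum_k w k = \sum_(k | `[< nu k =1 mu >]) w k.
Proof.
move=> wnu mx; apply/eqP; rewrite -subr_eq0; apply/eqP.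
apply: (@weight_vec_indep _ (index_enum I) (fun k => ~~ `[< nu k =1 mu >]) nu mu w) => //.
- move=> k /asboolPn nun; apply: contrapT => /forallNP ex; apply: nun => j.
  by apply/eqP/negPn/negP/ex.
- by apply: weight_vecB => //; apply: weight_vec_sum => k /asboolP nuk j; rewrite wnu nuk.
by rewrite (bigID (fun k => `[< nu k =1 mu >])) /= addrC addrK.
Qed.

End WeightVectors.

HB.instance Definition _ (F : fieldType) (p : nat) (a b : 'F_p) x :=
  GRing.isLinear.Build F (kac F a b) (kac F a b) _ (@kac_act F p a b x)
    (@kac_actP F p a b x).

(** * The weights of 1 (x) v_k and gamma (x) v_k *)

Section KacWeights.
Variables (F : fieldType) (p : nat) (charF : p \in [pchar F]).
Hypothesis p_gt2 : (2 < p)%N.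
Variables a b : 'F_p.
Local Notation N := (Phi (b - a)).+1.
Local Notation g := (env_in (gamma F)).
Local Notation tens := (@kac_tens F p a b).

Definition kac_h (j : bool) : {linear kac F a b -> kac F a b} :=
  @kac_act F p a b (if j then h2 F else h1 F).

Definition kac_basis (t : bool * 'I_N) : kac F a b :=
  tens (if t.1 then g else 1) (kac_v F t.2).

Definition kac_basis_weight (t : bool * 'I_N) (j : bool) : F :=
  (if j then ofFp F b - t.2%:R else ofFp F a + t.2%:R) + t.1%:R.

(** As matrices [h_i, gamma] = gamma for both i, so gamma has weight (1, 1). This is the source of
    the summand [t.1%:R] in [kac_basis_weight]. *)
Lemma bracket_gamma (j : bool) : let x := if j then h2 F else h1 F in
  env_in x * g = g * env_in x + g.
Proof.
move=> x; have [lin br] := @env_in_super_hom F 2 2 (p2 F).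
have x_homog : mx_homog false (val x).
  apply/eqP; rewrite -[RHS]submxK /=; congr block_mx; apply/matrixP => i k.
    rewrite /x; case: (j); rewrite !mxE -!val_eqE /= !inordK //=;
    by case: i k => [[|[|]]] // ? [[|[|]]]; rewrite //= subrr.
  rewrite /x; case: (j); rewrite !mxE -!val_eqE /= !inordK //=;
  by case: i k => [[|[|]]] // ? [[|[|]]]; rewrite //= subrr.
have xg : val (gamma F) = scomm false true (val x) (val (gamma F)).
  rewrite /scomm scale1r /x; case: (j); rewrite /= /gamma_mx /h1_mx /h2_mx /mx_unit.
    rewrite !(mulmxBl, mulmxBr) !mul_delta_mx_cond -!val_eqE /= !inordK //=.
    by rewrite ?mulr0n ?mulr1n !(subr0, sub0r, opprK, addr0, add0r, oppr0) // addrC.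
  rewrite !(mulmxBl, mulmxBr) !mul_delta_mx_cond -!val_eqE /= !inordK //=.
  by rewrite ?mulr0n ?mulr1n !(subr0, sub0r, opprK, addr0, add0r, oppr0) // addrC.
by rewrite {3}(br _ _ _ _ _ x_homog (gamma_homog F) xg) scale1r addrC subrK.
Qed.

Lemma kac_h_rep (j : bool) : exists n : lie_elt (p2_nonneg F),
  p2_incl n = (if j then h2 F else h1 F) /\
  kac_rep a b n = (if j then kac_h2 F a b else kac_h1 F a b).
Proof.
have mem : val (if j then h2 F else h1 F) \in p2_nonneg F.
  apply/andP; split; first exact: valP.
  apply/eqP/matrixP => i k; case: j; rewrite !mxE -!val_eqE /= !inordK //=;
  by case: i k => [[|[|]]] // ? [[|[|]]]; rewrite //= subrr.
exists (Sub (val (if j then h2 F else h1 F)) mem); split; first exact: val_inj.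
have [r1 r2 _ _ _] := kac_rep_basis F a b.
by case: j mem => mem; [apply: r2 | apply: r1].
Qed.

Lemma kac_basisP t : weight_vec kac_h (kac_basis_weight t) (kac_basis t).
Proof.
move=> j; case: t => e k; rewrite /kac_basis /kac_basis_weight /=.
have [n [nE rE]] := kac_h_rep j.
have hv u : tens (u * env_in (if j then h2 F else h1 F)) (kac_v F k) =
    (if j then ofFp F b - k%:R else ofFp F a + k%:R) *: tens u (kac_v F k).
  rewrite -nE (kac_tensB charF) rE -kac_tensZr; congr (tens _ _).
  rewrite /kac_v; apply/matrixP => i l.
  by case: j {nE rE n}; rewrite mul_diag_mx !mxE; case: (i =P k) => [->|]; rewrite ?mulr0.
have -> : kac_h j (tens (if e then g else 1) (kac_v F k)) =
    tens (env_in (if j then h2 F else h1 F) * (if e then g else 1)) (kac_v F k).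
  exact: kac_act_tens.
case: e.
  by rewrite bracket_gamma kac_tensDl hv scalerDl scale1r.
by rewrite mulr1 -[env_in _]mul1r hv addr0.
Qed.

Lemma kac_basis_span w : exists c : bool * 'I_N -> F, w = \sum_t c t *: kac_basis t.
Proof.
have [y [z ->]] := kac_spanned charF p_gt2 w.
exists (fun t => (if t.1 then z else y) t.2 0).
rewrite -(pair_bigA _ (fun e k => (if e then z else y) k 0 *: kac_basis (e, k))) /=.
have expand (u : env (p2 F)) (x : kac_M F a b) : tens u x = \sum_k x k 0 *: tens u (kac_v F k).
  rewrite {1}[x]matrix_sum_delta.
  rewrite (big_morph (tens u) (kac_tensDr u) (kac_tens0r a b u)).
  by apply: eq_bigr => k _; rewrite big_ord1 (kac_tensZr (x k 0) u (kac_v F k)).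
by rewrite big_bool addrC !expand.
Qed.

End KacWeights.

(** * The prime field, its representatives and its embedding in F *)

Section PrimeField.
Variables (p : nat) (p_pr : prime p).

Lemma Phi_nat n : Phi (n%:R : 'F_p) = (n %% p)%N.
Proof. by rewrite /Phi val_Fp_nat. Qed.

Lemma ltn_Phi (x : 'F_p) : (Phi x < p)%N.
Proof. by have := ltn_ord x; rewrite [X in (_ < X)%N]Fp_cast. Qed.

Lemma Phi_inj : injective (@Phi p).
Proof. exact: val_inj. Qed.

Lemma PhiK (x : 'F_p) : (Phi x)%:R = x.
Proof. by apply: Phi_inj; rewrite Phi_nat modn_small ?ltn_Phi. Qed.

Variables (F : fieldType) (charF : p \in [pchar F]).

Lemma ofFp_nat n : ofFp F (n%:R : 'F_p) = n%:R.
Proof.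
rewrite /ofFp Phi_nat [in RHS](divn_eq n p) natrD natrM (pcharf0 charF).
by rewrite mulr0 add0r.
Qed.

Lemma ofFpN (x : 'F_p) : ofFp F (- x) = - ofFp F x.
Proof. by apply/eqP; rewrite -addr_eq0 -ofFpD // addNr (ofFp_nat 0). Qed.

Lemma ofFp_int (z : int) : ofFp F (z%:~R : 'F_p) = z%:~R.
Proof.
case: z => n; first exact: ofFp_nat.
by rewrite NegzE !mulrNz ofFpN ofFp_nat.
Qed.

(** By additivity it suffices that [Phi (x - y)], a multiple of p smaller than p, is 0. Weight
    equations over F thereby descend to ['F_p]. *)
Lemma ofFp_inj : injective (@ofFp F p).
Proof.
move=> x y xy; apply/eqP; rewrite -subr_eq0; apply/eqP/Phi_inj.
have : ofFp F (x - y) = 0 by rewrite ofFpD // ofFpN xy subrr.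
move/eqP; rewrite /ofFp -(dvdn_pcharf charF) => /dvdnP [[|m] E]; first exact: E.
by have := ltn_Phi (x - y); rewrite E mulSn ltnNge leq_addr.
Qed.

End PrimeField.

(** * The weight spaces of K(lambda) for arbitrary integer weights *)

Section WeightSpaces.
Variables (F : fieldType) (p : nat) (charF : p \in [pchar F]).
Hypothesis p_gt2 : (2 < p)%N.
Variables a b : 'F_p.
Local Notation N := (Phi (b - a)).+1.
Local Notation g := (env_in (gamma F)).
Local Notation tens := (@kac_tens F p a b).
Let p_pr := pcharf_prime charF.

Definition int_weight (i j : int) (l : bool) : F := if l then j%:~R else i%:~R.

(** The h_1- and h_2-weights add up to a + b + 2e, free of k, which gives the first equation. The
    h_2-weight then fixes k in ['F_p], and as an integer because k <= Phi(b - a) < p. *)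
Lemma kac_basis_weight_eq (i j : int) (e : bool) (k : 'I_N) :
  kac_basis_weight F (e, k) =1 int_weight i j <->
  a + b = (i + j)%:~R - e%:R *+ 2 /\ k = Phi (b + e%:R - j%:~R) :> nat.
Proof.
have e1 : kac_basis_weight F (e, k) false = ofFp F (a + k%:R + e%:R).
  by rewrite !ofFpD // !(ofFp_nat p_pr).
have e2 : kac_basis_weight F (e, k) true = ofFp F (b - k%:R + e%:R).
  by rewrite !ofFpD // ofFpN // !(ofFp_nat p_pr).
have kP : Phi (k%:R : 'F_p) = k.
  rewrite Phi_nat // modn_small //.
  by have := ltn_ord k; rewrite ltnS => /leq_ltn_trans; apply; exact: (ltn_Phi p_pr).
split=> [wE|[abE kE] [|]].
- have E1 : a + k%:R + e%:R = i%:~R.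
    by apply: (ofFp_inj p_pr charF); rewrite -e1 wE (ofFp_int p_pr charF).
  have E2 : b - k%:R + e%:R = j%:~R.
    by apply: (ofFp_inj p_pr charF); rewrite -e2 wE (ofFp_int p_pr charF).
  rewrite intrD -E1 -E2; split; first by ring.
  by rewrite -[LHS]kP; congr Phi; ring.
- rewrite e2 /= -(ofFp_int p_pr charF); congr ofFp.
  by rewrite kE (PhiK p_pr); ring.
rewrite e1 /= -(ofFp_int p_pr charF); congr ofFp.
rewrite kE (PhiK p_pr) addrA addrA abE intrD.
by ring.
Qed.

Lemma kac_weightP (i j : int) w :
  kac_weight i j w <-> weight_vec (@kac_h F p a b) (int_weight i j) w.
Proof.
split=> [[w1 w2] [|]|wP]; [exact: w2 | exact: w1 |].
by split; [exact: (wP false) | exact: (wP true)].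
Qed.

Lemma kac_weight_span (i j : int) w : kac_weight i j w <->
  exists c : bool * 'I_N -> F,
    w = \sum_(t | `[< kac_basis_weight F t =1 int_weight i j >]) c t *: kac_basis F t.
Proof.
rewrite kac_weightP; split=> [wP|[c ->]]; last first.
  apply: weight_vec_sum => t /asboolP tE; apply: weight_vecZ => l.
  by rewrite kac_basisP ?tE.
have [c wE] := kac_basis_span charF p_gt2 w; exists c.
rewrite wE in wP *; apply: weight_vec_proj wP => t.
exact/weight_vecZ/kac_basisP.
Qed.

Lemma one_part : 1 \in env_part (L := p2 F) false.
Proof. by apply: lspan_gen; exists [::]; rewrite !big_nil. Qed.

Lemma gamma_part : g \in env_part (L := p2 F) true.
Proof.
apply: lspan_gen; exists [:: (true, gamma F)]; rewrite !big_seq1 /= andbT.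
by split=> //; apply: gamma_homog.
Qed.

Lemma kac_part0 e : 0 \in kac_part (F := F) (a := a) (b := b) e.
Proof. exact: rpred0. Qed.

Lemma kac_part_tens e u x : u \in env_part e -> tens u x \in kac_part e.
Proof. by move=> ue; apply: lspan_gen; exists u, x. Qed.

Lemma kac_weight_line (i j : int) (t : bool * 'I_N) :
  (forall s, `[< kac_basis_weight F s =1 int_weight i j >] = (s == t)) ->
  forall w, kac_weight i j w <-> exists c : F, w = c *: kac_basis F t.
Proof.
move=> tE w; rewrite kac_weight_span.
under eq_exists => c do rewrite (big_pred1 _ tE).
by split=> [[c ->]|[c ->]]; [exists (c t) | exists (fun=> c)].
Qed.

(** Given (i, j), the sum a + b decides the parity e, and then b decides k; the inequality says that
    v_k exists. *)
Lemma kac_weight_cases (i j : int) : weight_cases (@kac_weight F p a b i j)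
  ((a + b == (i + j)%:~R) && (Phi (b - j%:~R)%R <= Phi (b - a)%R)%N)
  (Phi (b - j%:~R))
  ((a + b == (i + j)%:~R - 2%:R) && (Phi (b + 1 - j%:~R)%R <= Phi (b - a)%R)%N)
  (Phi (b + 1 - j%:~R)).
Proof.
(* The even and the odd case prescribe values of a + b that differ by 2, so they exclude each
   other. *)
have two0 : 2%:R != 0 :> 'F_p.
  apply/negP => /eqP /(congr1 (@Phi p)); rewrite Phi_nat // modn_small //.
split.
- case/andP=> /eqP abE; rewrite -ltnS => kN.
  exists (Ordinal kN) => //; split; [exact/kac_part_tens/one_part | exact: kac_part0 |].
  move=> w; rewrite (@kac_weight_line i j (false, Ordinal kN)) => [|[[|] k]].
  + split=> [[c ->]|[c [d ->]]]; first by exists c, 0; rewrite scaler0 addr0.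
    by exists c; rewrite scaler0 addr0.
  + apply/negbTE/asboolPn => /kac_basis_weight_eq[abE' _].
    move/eqP: abE; rewrite abE' -subr_eq0 addrAC subrr add0r oppr_eq0.
    exact/negP.
  apply/asboolP/eqP => [/kac_basis_weight_eq[_ kE]|[->]].
    by congr pair; apply: val_inj; rewrite /= kE addr0.
  by apply/kac_basis_weight_eq; rewrite mul0rn subr0 addr0.
- case/andP=> /eqP abE; rewrite -ltnS => kN.
  exists (Ordinal kN) => //; split; [exact: kac_part0 | exact/kac_part_tens/gamma_part |].
  move=> w; rewrite (@kac_weight_line i j (true, Ordinal kN)) => [|[[|] k]].
  + split=> [[c ->]|[c [d ->]]]; first by exists 0, c; rewrite scaler0 add0r.
    by exists d; rewrite scaler0 add0r.
  + apply/asboolP/eqP => [/kac_basis_weight_eq[_ kE]|[->]].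
      by congr pair; apply: val_inj; rewrite /= kE.
    exact/kac_basis_weight_eq.
  apply/negbTE/asboolPn => /kac_basis_weight_eq[abE' _].
  move/eqP: abE; rewrite abE' mul0rn subr0 -subr_eq0 opprB addrC subrK.
  exact/negP.
case/andP=> n1 n2; split; [exact: kac_part0 | exact: kac_part0 |] => w.
have none (t : bool * 'I_N) : `[< kac_basis_weight F t =1 int_weight i j >] = false.
  case: t => e k; apply/negbTE/asboolPn => tw.
  have [abE kE] := (kac_basis_weight_eq i j e k).1 tw.
  have := ltn_ord k; rewrite ltnS kE => kN.
  case: e abE kE kN {tw} => abE kE kN; first by move: n2; rewrite abE eqxx kN.
  by move: n1 kN; rewrite abE mul0rn subr0 eqxx addr0 /= => /negPf ->.
rewrite kac_weight_span.
split=> [[c ->]|[c [d ->]]]; first by exists 0, 0; rewrite big_pred0 // !scaler0 addr0.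
by exists (fun=> 0); rewrite big_pred0 // !scaler0 addr0.
Qed.

End WeightSpaces.

(** * Residues modulo p as integers *)

Section PhiArithmetic.
Variables (p : nat) (p_pr : prime p).

Lemma Phi_int (z : int) : Posz (Phi (z%:~R : 'F_p)) = (z %% p)%Z.
Proof.
have p0 : (0 < p)%N := prime_gt0 p_pr.
have zE : z%:~R = (`|(z %% p)%Z|%N)%:R :> 'F_p.
  rewrite {1}(divz_eq z p) intrD intrM.
  have -> : (Posz p)%:~R = 0 :> 'F_p by apply/Phi_inj; rewrite -pmulrn Phi_nat // modnn.
  rewrite mulr0 add0r pmulrn gez0_abs ?modz_ge0 //; lia.
have := ltz_pmod z (d := p); have := modz_ge0 z (d := p).
by rewrite zE Phi_nat // modn_small; lia.
Qed.

(** Trades a residue for linear alternatives that [lia] can handle. For the seven weights, B - j and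
    2B - s lie between -2 and 2p + 2, inside the window since p >= 3. *)
Lemma modz_window (x : int) (P := Posz p) : - P <= x < 3 * P ->
  x < 0 /\ (x %% p)%Z = x + P \/ 0 <= x < P /\ (x %% p)%Z = x \/
  P <= x < 2 * P /\ (x %% p)%Z = x - P \/ 2 * P <= x /\ (x %% p)%Z = x - 2 * P.
Proof.
have p0 : (0 < p)%N := prime_gt0 p_pr.
have shift q : 0 <= x - q * P < P -> (x %% p)%Z = x - q * P.
  by move=> xq; rewrite -[x in LHS](subrK (q * P)) addrC modzMDl modz_small // ger0_norm.
move=> xP.
have : x < 0 \/ 0 <= x < P \/ P <= x < 2 * P \/ 2 * P <= x by lia.
by case=> [|[|[|]]] xq; [have := shift (-1) | have := shift 0 | have := shift 1 |
  have := shift 2]; lia.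
Qed.

End PhiArithmetic.

(** * Translation of the listed ranges into inequalities of residues *)

Section Conditions.
Variables (p : nat) (p_pr : prime p).
Variables a b : 'F_p.
Local Notation P := (Posz p).
Local Notation B := (Posz (Phi b)).

(** If a + b = s then b - a = 2b - s, so both sides of the inequality are residues of integers
    linear in B. [s1] and [s2] are the two spellings of s, in the theorem and in [kac_weight_cases],
    and [X] is the listed range for B. *)
Lemma weight_condition (s j : int) (s1 s2 k : 'F_p) (X : bool) :
  s1 = s%:~R -> s2 = s%:~R -> k = b - j%:~R ->
  X = ((B - j) %% P <= (2 * B - s) %% P)%Z ->
  X && (a + b == s1) = (a + b == s2) && (Phi k <= Phi (b - a)%R)%N.
Proof.
move=> -> -> -> XE; rewrite andbC; apply: andb_id2l => /eqP abE.
have bE : b = B%:~R by rewrite -pmulrn PhiK.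
rewrite XE -lez_nat.
have -> : b - j%:~R = (B - j)%:~R by rewrite intrB -bE.
have -> : b - a = (2 * B - s)%:~R by rewrite intrB intrM -bE -abE; ring.
by rewrite !Phi_int.
Qed.

End Conditions.

Lemma weight_cases_eq (F : fieldType) (p : nat) (a b : 'F_p)
    (W : kac F a b -> Prop) c1 k1 c2 k2 c1' k1' c2' k2' :
  weight_cases W c1 k1 c2 k2 -> c1' = c1 -> k1' = k1 -> c2' = c2 -> k2' = k2 ->
  weight_cases W c1' k1' c2' k2'.
Proof. by move=> WP -> -> -> ->. Qed.

Local Ltac weight_cond p_pr a b s j :=
  apply: (@weight_condition _ p_pr a b s j); [ring | ring | ring |];
  have := modz_window p_pr (x := Posz (Phi b) - j);
  have := modz_window p_pr (x := 2 * Posz (Phi b) - s);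
  move: (_ %% _)%Z (_ %% _)%Z; rewrite /in_range; lia.

(** Since gamma has weight (1, 1), the odd case at (i, j) is the even condition at (i - 1, j - 1),
    whence [i + j - 2] and [j - 1]. *)
Local Ltac weight_space p_pr a b cases i j :=
  apply: (weight_cases_eq (cases i j));
  [ weight_cond p_pr a b (i + j : int) j | congr Phi; ring
  | weight_cond p_pr a b (i + j - 2 : int) (j - 1 : int) | congr Phi; ring ].

Theorem proposition4p1 (F : fieldType) (p : nat) (charF : p \in [pchar F])
    (p_gt2 : (2 < p)%N) (a b : 'F_p) :
  let K (i j : int) : kac F a b -> Prop := @kac_weight F p a b i j in
  let P : int := Posz p in
  let B : int := Posz (Phi b) in
  weight_cases (K (-2) 0)
    ((in_range 0 ((P - 3) %/ 2)%Z B || (B == P - 2)) && (a + b == - 2%:R))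
      (Phi b)
    ((in_range 0 ((P - 5) %/ 2)%Z B || (B == P - 1) || (B == P - 3))
       && (a + b == - 4%:R))
      (Phi (b + 1)) /\
  weight_cases (K (-1) (-1))
    ((in_range 0 ((P - 3) %/ 2)%Z B || (B == P - 1)) && (a + b == - 2%:R))
      (Phi (b + 1))
    ((in_range 0 ((P - 5) %/ 2)%Z B || (B == P - 1) || (B == P - 2))
       && (a + b == - 4%:R))
      (Phi (b + 2%:R)) /\
  weight_cases (K (-1) 1)
    ((in_range 1 ((P - 1) %/ 2)%Z B || (B == P - 1)) && (a + b == 0))
      (Phi (b - 1))
    ((in_range 0 ((P - 3) %/ 2)%Z B || (B == P - 2)) && (a + b == - 2%:R))
      (Phi b) /\
  weight_cases (K 0 (-2))
    ((in_range 0 ((P - 3) %/ 2)%Z B || (B == P - 2)) && (a + b == - 2%:R))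
      (Phi (b + 2%:R))
    ((in_range 0 ((P - 5) %/ 2)%Z B || (B == P - 1) || (B == P - 3))
       && (a + b == - 4%:R))
      (Phi (b + 3%:R)) /\
  weight_cases (K 1 (-1))
    ((in_range 1 ((P - 1) %/ 2)%Z B || (B == P - 1)) && (a + b == 0))
      (Phi (b + 1))
    ((in_range 0 ((P - 3) %/ 2)%Z B || (B == P - 2)) && (a + b == - 2%:R))
      (Phi (b + 2%:R)) /\
  weight_cases (K 1 1)
    (in_range 1 ((P + 1) %/ 2)%Z B && (a + b == 2%:R))
      (Phi (b - 1))
    (in_range 0 ((P - 1) %/ 2)%Z B && (a + b == 0))
      (Phi b) /\
  weight_cases (K 0 0)
    (in_range 0 ((P - 1) %/ 2)%Z B && (a + b == 0))
      (Phi b)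
    ((in_range 0 ((P - 3) %/ 2)%Z B || (B == P - 1)) && (a + b == - 2%:R))
      (Phi (b + 1)).
Proof.
have p_pr := pcharf_prime charF.
have p_odd : odd p by case: (even_prime p_pr) p_gt2 => [->|].
(* Writes p as 1 plus an even number, so that [lia] can evaluate the halves bounding the ranges. *)
have pE := odd_double_half p; rewrite p_odd in pE.
have Bp := ltn_Phi p_pr b.
move=> K P B.
have cases i j := kac_weight_cases charF p_gt2 a b i j.
do 6?apply: conj.
- weight_space p_pr a b cases (-2 : int) (0 : int).
- weight_space p_pr a b cases (-1 : int) (-1 : int).
- weight_space p_pr a b cases (-1 : int) (1 : int).
- weight_space p_pr a b cases (0 : int) (-2 : int).
- weight_space p_pr a b cases (1 : int) (-1 : int).
- weight_space p_pr a b cases (1 : int) (1 : int).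
- weight_space p_pr a b cases (0 : int) (0 : int).
Qed.
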